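(* Let $\mathcal{P}$ be a projective class on a category $\mathcal{C}$. Let $P=(P_n)_{n\geq -1}$ be an augmented simplicial object in $\mathcal{C}$ with $P_{-1}=X$ and $P_i\in\mathcal{P}$ for every $i\geq 0$, and let $A=(A_n)_{n\geq -1}$ be an augmented simplicial object in $\mathcal{C}$ with $A_{-1}=Y$, such that for every $i\geq 0$ the augmented simplicial set $\mathrm{Hom}(P_i,A)$ is contractible and Kan. Then any map $f\colon X\to Y$ can be extended to a semi-simplicial map $f\colon P\to A$ (with $f_{-1}=f$), and any two such extensions are simplicially homotopic.
   Context: Projective classes. For an object $P$ and a morphism $e\colon X\to Y$ of $\mathcal{C}$, say that $P$ is $e$-projective and $e$ is $P$-epic if $e\circ(\cdot)\colon \mathrm{Hom}(P,X)\to\mathrm{Hom}(P,Y)$ is surjective. A projective class on $\mathcal{C}$ is a pair $(\mathcal{P},\mathcal{E})$, with $\mathcal{P}$ a class of objects and $\mathcal{E}$ a class of morphisms, such that $\mathcal{P}$ is the class of all objects that are $e$-projective for every $e\in\mathcal{E}$, $\mathcal{E}$ is the class of all morphisms that are $P$-epic for every $P\in\mathcal{P}$, and for every object $Y$ there is a morphism $P\to Y$ in $\mathcal{E}$ with $P\in\mathcal{P}$. Since $\mathcal{P}$ determines $\mathcal{E}$, one speaks of ''the projective class $\mathcal{P}$''. A simplicial set $S$ is Kan if for all $n\geq 1$ and $0\leq k\leq n$, every family $(s_i)_{0\leq i\leq n,\,i\neq k}$ in $S_{n-1}$ with $\partial_i(s_j)=\partial_{j-1}(s_i)$ for all $i<j$,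 $i,j\neq k$ (an $(n,k)$-horn), has a filler $s\in S_n$ with $\partial_i(s)=s_i$ for all $i\neq k$; an augmented simplicial set is Kan if the underlying simplicial set (degrees $\geq 0$) is. An augmented simplicial object $(A_n)_{n\geq -1}$ is contractible if there are maps $h_n\colon A_n\to A_{n+1}$, $n\geq -1$, with $\partial_0h_n=1_{A_n}$ and $\partial_ih_n=h_{n-1}\partial_{i-1}$ for $i>0$. A semi-simplicial map between (augmented) simplicial objects is a family of maps commuting with all face operators $\partial_i$ (including the augmentation) but not necessarily with the degeneracies. Two semi-simplicial maps $f,g\colon P\to A$ are simplicially homotopic if there are maps $h^n_i\colon P_n\to A_{n+1}$, for $n\geq 0$ and $0\leq i\leq n$, with $\partial_0h^n_0=f_n$, $\partial_{n+1}h^n_n=g_n$, and $\partial_ih^n_j=h^{n-1}_{j-1}\partial_i$ for $i<j$, $\partial_ih^n_i=\partial_ih^n_{i-1}$ for $i=j\neq 0$, $\partial_ih^n_j=h^{n-1}_j\partial_{i-1}$ for $i>j+1$. *)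

(* Defs.v *)
From Stdlib Require Import FunctionalExtensionality.
From mathcomp Require Import all_boot.

Set Implicit Arguments.
Unset Strict Implicit.
Unset Printing Implicit Defensive.

Declare Scope cat_scope.
Delimit Scope cat_scope with cat.

Record Category := {
  Obj :> Type;
  Hom : Obj -> Obj -> Type;
  idm : forall X, Hom X X;
  comp : forall X Y Z, Hom Y Z -> Hom X Y -> Hom X Z;
  comp_idl : forall X Y (f : Hom X Y), comp (idm Y) f = f;
  comp_idr : forall X Y (f : Hom X Y), comp f (idm X) = f;
  comp_assoc : forall W X Y Z (h : Hom Y Z) (g : Hom X Y) (f : Hom W X),
    comp h (comp g f) = comp (comp h g) f
}.
Arguments Hom {c} X Y.
Arguments idm {c} X.
Arguments comp {c X Y Z} g f.

Notation "X ~> Y" := (Hom X Y) (at level 60, no associativity) : cat_scope.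
Notation "g ∘ f" := (comp g f) (at level 40, left associativity) : cat_scope.
Local Open Scope cat_scope.

Definition TypeCat : Category := {|
  Obj := Type;
  Hom := fun X Y => X -> Y;
  idm := fun X x => x;
  comp := fun X Y Z g f x => g (f x);
  comp_idl := fun X Y f => erefl;
  comp_idr := fun X Y f => erefl;
  comp_assoc := fun W X Y Z h g f => erefl
|}.

(* [P] is [e]-projective; equivalently (same condition), [e] is [P]-epic. *)
Definition epic_for (C : Category) (P X Y : C) (e : X ~> Y) : Prop :=
  forall v : P ~> Y, exists u : P ~> X, e ∘ u = v.

Record ProjectiveClass (C : Category) := {
  projective : C -> Prop;
  epic : forall X Y : C, X ~> Y -> Prop;
  projectiveP : forall P : C,
    projective P <-> (forall (X Y : C) (e : X ~> Y), epic e -> epic_for P e);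
  epicP : forall (X Y : C) (e : X ~> Y),
    epic e <-> (forall P : C, projective P -> epic_for P e);
  enough_projectives : forall Y : C,
    exists (P : C) (e : P ~> Y), projective P /\ epic e
}.

(* Indices are shifted by one: for an augmented simplicial object [A], the
   object written [A n] here sits in degree n - 1, so [A 0] is A_{-1} and
   [A n.+1] is A_n. Thus [face A n i] is d_i : A_n -> A_{n-1} for
   0 <= i <= n, the augmentation being [face A 0 ord0], and [degen A n i] is
   s_i : A_n -> A_{n+1} for 0 <= i <= n.
   In the identities, indices are natural numbers with explicit bounds under
   which every [inord] is applied to a number within range. *)
Record AugSimplicial (C : Category) := {
  aug_ob :> nat -> C;
  face : forall n, 'I_n.+1 -> aug_ob n.+1 ~> aug_ob n;
  degen : forall n, 'I_n.+1 -> aug_ob n.+1 ~> aug_ob n.+2;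
  face_face : forall n i j, i < j -> j <= n.+1 ->
    face (inord i : 'I_n.+1) ∘ face (inord j : 'I_n.+2)
    = face (inord j.-1 : 'I_n.+1) ∘ face (inord i : 'I_n.+2);
  face_degen_lt : forall n i j, i < j -> j <= n.+1 ->
    face (inord i : 'I_n.+3) ∘ degen (inord j : 'I_n.+2)
    = degen (inord j.-1 : 'I_n.+1) ∘ face (inord i : 'I_n.+2);
  face_degen_eq : forall n j, j <= n ->
    face (inord j : 'I_n.+2) ∘ degen (inord j : 'I_n.+1)
    = idm (aug_ob n.+1);
  face_degen_succ : forall n j, j <= n ->
    face (inord j.+1 : 'I_n.+2) ∘ degen (inord j : 'I_n.+1)
    = idm (aug_ob n.+1);
  face_degen_gt : forall n i j, j.+1 < i -> i <= n.+2 ->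
    face (inord i : 'I_n.+3) ∘ degen (inord j : 'I_n.+2)
    = degen (inord j : 'I_n.+1) ∘ face (inord i.-1 : 'I_n.+2);
  degen_degen : forall n i j, i <= j -> j <= n ->
    degen (inord i : 'I_n.+2) ∘ degen (inord j : 'I_n.+1)
    = degen (inord j.+1 : 'I_n.+2) ∘ degen (inord i : 'I_n.+1)
}.
Arguments face {C} a n i.
Arguments degen {C} a n i.

Definition contractible (C : Category) (A : AugSimplicial C) : Prop :=
  exists h : forall n, A n ~> A n.+1,
    (forall n, face A n ord0 ∘ h n = idm (A n)) /\
    (forall n i, 0 < i -> i <= n.+1 ->
       face A n.+1 (inord i) ∘ h n.+1 = h n ∘ face A n (inord i.-1)).

(* Fillers for all (n.+1, k)-horns. A horn is given as a total family [s] whose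
   value at [k] is ignored. For n = 0 there are no i < j different from [k], so
   the augmentation plays no role. *)
Definition kan (S : AugSimplicial TypeCat) : Prop :=
  forall n (k : 'I_n.+2) (s : 'I_n.+2 -> S n.+1),
    (forall i j : 'I_n.+2, i < j -> i != k -> j != k ->
       face S n (inord i) (s j) = face S n (inord j.-1) (s i)) ->
    exists t : S n.+2, forall i : 'I_n.+2, i != k -> face S n.+1 i t = s i.

Section HomSimplicialSet.
Variables (C : Category) (Q : C) (A : AugSimplicial C).

Lemma hom_comp_eq (X Y Y' Z : C) (g : Y ~> Z) (f : X ~> Y)
    (g' : Y' ~> Z) (f' : X ~> Y') :
  g ∘ f = g' ∘ f' ->
  (fun u : Q ~> X => g ∘ (f ∘ u)) = (fun u : Q ~> X => g' ∘ (f' ∘ u)).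
Proof.
by move=> e; apply: functional_extensionality => u; rewrite !comp_assoc e.
Qed.

Lemma hom_comp_id (X Y : C) (g : Y ~> X) (f : X ~> Y) :
  g ∘ f = idm X -> (fun u : Q ~> X => g ∘ (f ∘ u)) = id.
Proof.
by move=> e; apply: functional_extensionality => u; rewrite comp_assoc e comp_idl.
Qed.

(* The augmented simplicial set Hom(Q, A). *)
Definition hom_aug : AugSimplicial TypeCat := {|
  aug_ob := (fun n => Q ~> A n) : nat -> TypeCat;
  face := fun n i u => face A n i ∘ u;
  degen := fun n i u => degen A n i ∘ u;
  face_face := fun n i j ij jn => hom_comp_eq (face_face A ij jn);
  face_degen_lt := fun n i j ij jn => hom_comp_eq (face_degen_lt A ij jn);
  face_degen_eq := fun n j jn => hom_comp_id (face_degen_eq A jn);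
  face_degen_succ := fun n j jn => hom_comp_id (face_degen_succ A jn);
  face_degen_gt := fun n i j ij jn => hom_comp_eq (face_degen_gt A ij jn);
  degen_degen := fun n i j ij jn => hom_comp_eq (degen_degen A ij jn)
|}.

End HomSimplicialSet.

Record SemiSimplicialMap (C : Category) (P A : AugSimplicial C) := {
  ssmap :> forall n, P n ~> A n;
  ssmap_face : forall n (i : 'I_n.+1),
    face A n i ∘ ssmap n.+1 = ssmap n ∘ face P n i
}.

(* [h n i] is h^n_i : P_n -> A_{n+1}. *)
Definition simplicially_homotopic (C : Category) (P A : AugSimplicial C)
    (f g : SemiSimplicialMap P A) : Prop :=
  exists h : forall n, 'I_n.+1 -> P n.+1 ~> A n.+2,
    [/\ forall n, face A n.+1 ord0 ∘ h n ord0 = f n.+1,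
        forall n, face A n.+1 ord_max ∘ h n ord_max = g n.+1,
        forall n i j, i < j -> j <= n.+1 ->
          face A n.+2 (inord i) ∘ h n.+1 (inord j)
          = h n (inord j.-1) ∘ face P n.+1 (inord i),
        forall n i, 0 < i -> i <= n ->
          face A n.+1 (inord i) ∘ h n (inord i)
          = face A n.+1 (inord i) ∘ h n (inord i.-1)
      & forall n i j, j.+1 < i -> i <= n.+2 ->
          face A n.+2 (inord i) ∘ h n.+1 (inord j)
          = h n (inord j) ∘ face P n.+1 (inord i.-1)].

(* Main.v *)
Require Import Defs.
From Stdlib Require Import ClassicalEpsilon.
From mathcomp Require Import all_boot zify.

Set Implicit Arguments.
Unset Strict Implicit.
Unset Printing Implicit Defensive.

Local Open Scope cat_scope.

(** Contractibility and the Kan condition together fill spheres: if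
    [s_0, ..., s_n] have matching faces and [h] is the contraction, then
    [h s_0, ..., h s_n] form a horn lacking only its zeroth face, and the
    zeroth face of a filler of this horn has faces [s_0, ..., s_n].
    Applied to Hom(P_q, A), this produces morphisms P_q -> A_n with any
    matching family of prescribed faces. The extension of [f] is built degree
    by degree in this way. For a homotopy from [F] to [G], one first builds its
    interior walls m_0 = F, m_1, ..., m_(n+1) = G, where m_j is to be the
    common face d_j h_j = d_j h_(j-1); all the faces of each m_j are
    determined in lower degree, and then so are all the faces of each h_j. *)

Notation d X n i := (face X n (inord i)).

Lemma inord0 n : inord 0 = ord0 :> 'I_n.+1.
Proof. exact: (inord_val ord0). Qed.

Section SphereFilling.
Variable S : AugSimplicial TypeCat.

(* For n = 0 the sphere is a single point of degree -1. *)
Definition matching n : (nat -> S n) -> Prop :=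
  if n is m.+1 return (nat -> S n) -> Prop then
    fun s => forall i j, i < j -> j <= m.+1 ->
      d S m i (s j) = d S m j.-1 (s i)
  else fun _ => True.

Lemma sphere_filler n (s : nat -> S n) :
  contractible S -> kan S -> matching s ->
  exists t : S n.+1, forall i, i <= n -> d S n i t = s i.
Proof.
move=> [h [h0 hS]] Skan.
have {}h0 m x : d S m 0 (h m x) = x.
  by rewrite inord0; apply: (congr1 (@^~ x) (h0 m)).
have {}hS m i x : i <= m -> d S m.+1 i.+1 (h m.+1 x) = h m (d S m i x).
  by move=> im; apply: (congr1 (@^~ x) (hS m i.+1 isT _)).
case: n s => [|n] s sm.
  by exists (h 0 (s 0)) => -[|//] _; rewrite h0.
(* The entry at 0 is a dummy: it sits at the missing face of the horn. *)
have [|t tE] := Skan n.+1 ord0 (fun i => h n.+1 (s i.-1)).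
  move=> [[|i] ilt] [[|j] jlt] //= ij _ _.
  case: j => [|j] in jlt ij *; first by lia.
  by rewrite hS 1?hS 1?sm //; lia.
exists (d S n.+2 0 t) => i ile.
have -> : d S n.+1 i (d S n.+2 0 t) = d S n.+1 0 (d S n.+2 i.+1 t).
  exact: esym (congr1 (@^~ t) (face_face S (ltn0Sn i) _)).
rewrite tE ?h0 ?inordK //; last by rewrite -val_eqE /= inordK.
Qed.

End SphereFilling.

Section Extension.
Variables (C : Category) (P A : AugSimplicial C).
Hypothesis A_contr_kan : forall i,
  contractible (hom_aug (P i.+1) A) /\ kan (hom_aug (P i.+1) A).

(** With matching as a premise under the existential, [fill] is total, so [extend], [wall] and
    [prism] can be plain recursions whose matching is proved afterwards. *)
Lemma filler_exists q n (s : nat -> P q.+1 ~> A n) :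
  exists t : P q.+1 ~> A n.+1,
    matching (S := hom_aug (P q.+1) A) s ->
    forall i, i <= n -> d A n i ∘ t = s i.
Proof.
have [contr fillable] := A_contr_kan q.
have [sm|nsm] := classic (matching (S := hom_aug (P q.+1) A) s).
  by have [t tE] := sphere_filler contr fillable sm; exists t.
(* Without matching any morphism will do; the contraction supplies one. *)
by have [h _] := contr; exists (h n (s 0)).
Qed.

Definition fill q n (s : nat -> P q.+1 ~> A n) : P q.+1 ~> A n.+1 :=
  proj1_sig (constructive_indefinite_description _ (filler_exists s)).

Lemma face_fill q n (s : nat -> P q.+1 ~> A n) i :
  matching (S := hom_aug (P q.+1) A) s -> i <= n -> d A n i ∘ fill s = s i.
Proof.
by rewrite /fill; case: constructive_indefinite_description => t /= tE /tE; apply.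
Qed.

Section ExtendMap.
Variable f : P 0 ~> A 0.

Fixpoint extend n : P n ~> A n :=
  if n is m.+1 then fill (fun i => extend m ∘ d P m i) else f.

Lemma face_extend n i : i <= n ->
  d A n i ∘ extend n.+1 = extend n ∘ d P n i.
Proof.
elim: n i => [|n IH] i ile; rewrite face_fill //= => {ile}i j ij jle.
rewrite !comp_assoc !IH; try lia.
by rewrite -!comp_assoc face_face.
Qed.

Lemma extension_exists : exists F : SemiSimplicialMap P A, F 0 = f.
Proof.
have FE n (i : 'I_n.+1) : face A n i ∘ extend n.+1 = extend n ∘ face P n i.
  by rewrite -(inord_val i) face_extend // -ltnS.
by exists (Build_SemiSimplicialMap FE).
Qed.

End ExtendMap.

Section Homotopy.
Variables F G : SemiSimplicialMap P A.
Hypothesis FG0 : F 0 = G 0.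

(* With the index shift, [wall n.+1 j] is m_j : P_n -> A_n for
   0 <= j <= n + 1; in degree -1 only m_0 = f is meaningful. *)
Fixpoint wall n j : P n ~> A n :=
  if n is m.+1 then
    if j == 0 then F m.+1 else if j == m.+1 then G m.+1 else
    fill (fun i => wall m (if i < j then j.-1 else j) ∘ d P m i)
  else F 0.

Lemma wall0 n : wall n 0 = F n. Proof. by case: n. Qed.

Lemma wall_max n : wall n n = G n.
Proof. by case: n => //= n; rewrite eqxx. Qed.

(** Think of m_j as a section of the prism over a simplex, with the vertices below j on the [G] side
    and the others on the [F] side: deleting a vertex i < j leaves j - 1 on the [G] side, deleting
    any other leaves j. *)
Lemma face_wall n i j : i <= n -> j <= n.+1 ->
  d A n i ∘ wall n.+1 j = wall n (if i < j then j.-1 else j) ∘ d P n i.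
Proof.
elim: n i j => [|n IH] i j ile jle.
  (* For j = 1 the wall is [G], whose augmentation agrees with that of [F] by [FG0]. *)
  case: i ile => // _; case: j jle => [|[|//]] _ /=; rewrite ssmap_face //.
  by rewrite FG0.
rewrite [wall n.+2 j]/=; case: eqP => [->|j0].
  by rewrite ltn0 wall0 ssmap_face.
case: eqP => [->|jn]; first by rewrite ltnS ile wall_max ssmap_face.
rewrite face_fill // => {ile}i k ik kle.
rewrite [LHS]comp_assoc [RHS]comp_assoc !IH; try (case: ifP; lia).
all: try lia.
rewrite -!comp_assoc face_face //; congr (wall _ _ ∘ _).
by do !case: ifP; lia.
Qed.

Lemma face_wall_lt n i j : i < j -> j <= n.+1 ->
  d A n i ∘ wall n.+1 j = wall n j.-1 ∘ d P n i.
Proof. by move=> ij jle; rewrite face_wall ?ij //; lia. Qed.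

Lemma face_wall_ge n i j : j <= i -> i <= n ->
  d A n i ∘ wall n.+1 j = wall n j ∘ d P n i.
Proof. by move=> ji ile; rewrite face_wall ?ltnNge ?ji //; lia. Qed.

(* The homotopy h^n_j, with faces j and j + 1 prescribed to be walls. *)
Fixpoint prism n j : P n.+1 ~> A n.+2 :=
  if n is m.+1 then
    fill (fun i =>
      if i < j then prism m j.-1 ∘ d P m.+1 i
      else if j.+1 < i then prism m j ∘ d P m.+1 i.-1
      else wall m.+2 i)
  else fill (fun i => wall 1 i).

(** Walls and outer faces need a joint induction: matching for h^(n+1)_j uses both for h^n. Outer
    faces start at n = 1, being expressed through h^(n-1). *)
Lemma prism_faces n j : j <= n ->
  [/\ d A n.+1 j ∘ prism n j = wall n.+1 j,
      d A n.+1 j.+1 ∘ prism n j = wall n.+1 j.+1 &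
      if n is m.+1 then
        (forall i, i < j -> d A m.+2 i ∘ prism m.+1 j
                            = prism m j.-1 ∘ d P m.+1 i) /\
        (forall i, j.+1 < i -> i <= m.+2 ->
           d A m.+2 i ∘ prism m.+1 j = prism m j ∘ d P m.+1 i.-1)
      else True].
Proof.
elim: n j => [|n IH] j jle.
  have {jle}-> : j = 0 by lia.
  suff sm : matching (S := hom_aug (P 1) A) (wall 1).
    by split=> //; apply: face_fill sm _.
  move=> i k ik kle; have [-> ->] : i = 0 /\ k = 1 by lia.
  by rewrite /= !ssmap_face FG0.
rewrite [prism n.+1 j]/=; set s := (s in fill s).
have slt i : i < j -> s i = prism n j.-1 ∘ d P n.+1 i by rewrite /s => ->.
have sgt i : j.+1 < i -> s i = prism n j ∘ d P n.+1 i.-1.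
  by move=> ji; rewrite /s ji ltnNge (leq_trans _ (ltnW ji)).
have smid i : j <= i <= j.+1 -> s i = wall n.+2 i.
  by rewrite /s => ij; do 2?[case: ifP; first by lia].
suff sm : matching (S := hom_aug (P n.+2) A) s.
  split; [| |split=> [i ij|i ji ile]]; rewrite face_fill //; try lia.
  - by apply: smid; lia.
  - by apply: smid; lia.
  - exact: slt.
  - exact: sgt.
clearbody s => i k ik kle; rewrite [LHS]/= [RHS]/=.
(* Each index lies below, on or above the pair of walls j, j + 1; with i < k six cases remain. *)
have [ij|ji] := ltnP i j; last have [ij|{}ji] := leqP i j.+1.
- rewrite (slt i) //; have [kj|jk] := ltnP k j; last have [kj|{}jk] := leqP k j.+1.
  (* i < k < j <= n + 1 excludes n = 0, where outer identities are absent. *)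
  + case: n => [|n] in IH jle s slt sgt smid kle *; first by lia.
    have [|_ _ [lt _]] := IH j.-1; first by lia.
    rewrite slt // !comp_assoc !lt; try lia.
    by rewrite -!comp_assoc face_face //; lia.
  + rewrite smid ?jk ?kj // face_wall_lt; try lia.
    have [|Ej Ej1 _] := IH j.-1; first by lia.
    rewrite comp_assoc; congr (_ ∘ _).
    (* Thus k - 1 indexes one of the two walls of h_(j-1). *)
    have [->|->] : k = j \/ k = j.+1 by lia.
      by rewrite Ej.
    by rewrite -{2}(ltn_predK ij) Ej1 (ltn_predK ij).
  + case: n => [|n] in IH jle s slt sgt smid kle *; first by lia.
    have [|_ _ [lt _]] := IH j; first by lia.
    have [|_ _ [_ gt]] := IH j.-1; first by lia.
    rewrite sgt // !comp_assoc lt ?gt; try lia.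
    by rewrite -!comp_assoc face_face //; lia.
- rewrite (smid i) ?ij ?ji //.
  have [kj|jk] := leqP k j.+1.
    have [-> ->] : i = j /\ k = j.+1 by lia.
    rewrite smid ?leqnn ?leqnSn // face_wall_lt ?face_wall_ge //; lia.
  have [|Ej Ej1 _] := IH j; first by lia.
  rewrite sgt // comp_assoc face_wall_ge; try lia.
  congr (_ ∘ _); have [->|->] // : i = j \/ i = j.+1 by lia.
- case: n => [|n] in IH jle s slt sgt smid kle *; first by lia.
  have [|_ _ [_ gt]] := IH j; first by lia.
  rewrite !sgt ?comp_assoc ?gt; try lia.
  by rewrite -!comp_assoc face_face //; lia.
Qed.

Lemma homotopic : simplicially_homotopic F G.
Proof.
exists (fun n j => prism n j); split.
- by move=> n; have [//|+ _ _] := @prism_faces n 0; rewrite inord0 wall0.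
- move=> n; have [//|_ + _] := @prism_faces n n.
  by rewrite wall_max -[ord_max]inord_val.
- move=> n i j ij jle; rewrite !inordK; try lia.
  by have [//|_ _ [lt _]] := @prism_faces n.+1 j; apply: lt.
- move=> n i i0 ile; rewrite !inordK; try lia.
  (* Both sides are the wall m_i. *)
  have [//|-> _ _] := @prism_faces n i.
  have [|_ + _] := @prism_faces n i.-1; first by lia.
  by rewrite (ltn_predK i0).
- move=> n i j ji ile; rewrite !inordK; try lia.
  have [|_ _ [_ gt]] := @prism_faces n.+1 j; first by lia.
  exact: gt.
Qed.

End Homotopy.
End Extension.

Theorem theorem3p3 (C : Category) (PC : ProjectiveClass C)
    (P A : AugSimplicial C)
    (P_proj : forall i, projective PC (P i.+1))
    (A_contr_kan : forall i,
       contractible (hom_aug (P i.+1) A) /\ kan (hom_aug (P i.+1) A))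
    (f : Hom (P 0) (A 0)) :
  (exists F : SemiSimplicialMap P A, F 0 = f) /\
  (forall F G : SemiSimplicialMap P A,
     F 0 = f -> G 0 = f -> simplicially_homotopic F G).
Proof.
split; first exact: extension_exists.
by move=> F G F0 G0; apply: homotopic; rewrite ?F0 ?G0.
Qed.
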